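(* For all $n,s,h \in \mathbb{Z}^+$ with $1 \leq s \leq n-2$, $\gcd(s,n)=1$, and $0 \leq h \leq n-1$, there is an $s$-overlap cycle for $\mathcal{W}(n,h)$.
   Context: $\mathcal{W}(n)$ denotes the set of weak orders on $[n]$ (transitive and complete relations), represented as words: $\mathcal{W}(n)$ is the set of all words $w_1w_2\ldots w_n$ of length $n$ over the nonnegative integers such that $\{w_1,\dots,w_n\} = \{0,1,\dots,h\}$ for some $h$ with $0 \le h \le n-1$ (here $w_j$ is the height of element $j$ in the weak order). This $h$, i.e. the maximum letter of $w$, is the height of $w$, and $\mathcal{W}(n,h)$ is the set of $w \in \mathcal{W}(n)$ of height $h$; that is, the set of words $w_1\ldots w_n$ with $\{w_1,\dots,w_n\}=\{0,1,\dots,h\}$. An $s$-overlap cycle ($s$-ocycle) for a set of words of length $n$ is a cyclically ordered listing of the words in the set, each appearing exactly once, such that the last $s$ letters of each word are the first $s$ letters (in the same order) of its successor in the listing (the successor of the last word being the first word). *)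

(* Defs.v *)
From mathcomp Require Import all_boot.

Set Implicit Arguments.
Unset Strict Implicit.
Unset Printing Implicit Defensive.

(* Weak orders on [n] as words: letter number j is the height of element j. *)
Definition weak_order (n : nat) (w : n.-tuple nat) : Prop :=
  exists h : nat, h <= n - 1 /\ (forall x : nat, (x \in w) = (x <= h)).

Definition height (n : nat) (w : n.-tuple nat) : nat := \max_(x <- w) x.

Definition weak_order_of_height (n h : nat) (w : n.-tuple nat) : Prop :=
  weak_order w /\ height w = h.

Lemma weak_order_of_heightP (n h : nat) (w : n.-tuple nat) : h <= n - 1 ->
  weak_order_of_height h w <-> (forall x : nat, (x \in w) = (x <= h)).
Proof.
have maxE k : (forall x : nat, (x \in w) = (x <= k)) -> height w = k.
  move=> wE; apply/eqP; rewrite eqn_leq; apply/andP; split.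
    by apply/bigmax_leqP_seq => x; rewrite wE.
  by apply: (@leq_bigmax_seq _ (tval w) xpredT id); rewrite // wE.
move=> hn; split=> [[[k [_ wE]] <-]|wE]; first by rewrite (maxE k wE).
by split; [exists h | exact: maxE].
Qed.

Definition overlap (T : eqType) (n s : nat) : rel (n.-tuple T) :=
  fun u v => drop (n - s) u == take s v.

(* [cycle] also relates the last word to the first one; in particular a
   one-word listing requires that the word overlap itself. *)
Definition is_ocycle (T : eqType) (n s : nat) (P : n.-tuple T -> Prop)
    (c : seq (n.-tuple T)) : Prop :=
  [/\ uniq c, (forall w, w \in c <-> P w) & cycle (overlap s) c].

(* Main.v *)
(** Words are the edges of a digraph whose vertices are the [s]-letter words,
    each word running from its prefix to its suffix; an [s]-ocycle is an Euler
    circuit.  Rotation is a permutation of the words sending each one to a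
    successor.  Among all such permutations, take one with the fewest cycles:
    two words with the same prefix lie in one cycle, since otherwise composing
    with their transposition would merge two cycles.  Hence its cycles are
    unions of connected components.  The graph is connected: since [s] and [n]
    are coprime all rotations of a word are connected, so (as [n - s >= 2])
    adjacent letters may be swapped anywhere, and a repeated letter may be
    replaced by an arbitrary one. *)
Require Import Defs.
From mathcomp Require Import fingroup perm all_boot.
From mathcomp Require Import zify.

(** The permutation [f] witnesses that every vertex has as many incoming as outgoing edges, and
    [conn] expresses connectivity: a set of edges closed under adjacency is empty or everything. *)
Lemma euler_circuit (E : finType) (V : eqType) (src tgt : E -> V)
    (f : {perm E}) :
  (forall u, src (f u) = tgt u) ->
  (forall A : {set E},
     closed [rel u v | (src u == src v) || (tgt u == src v)] A ->
     forall u v, (u \in A) = (v \in A)) ->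
  exists c : seq E,
    [/\ uniq c, forall u, u \in c & cycle [rel u v | tgt u == src v] c].
Proof.
move=> src_f conn.
pose follows (p : {perm E}) := [forall u, src (p u) == tgt u].
have follows_f : follows f by apply/forallP=> u; apply/eqP.
case: (arg_minnP (fun p : {perm E} => #|porbits p|) follows_f) => p.
move=> /forallP src_p p_min.
have same_src u v : src u = src v -> u \in porbit p v.
  move=> uv; apply/negPn/negP=> nuv.
  have /p_min : follows (p * tperm u v)%g.
    apply/forallP=> w; rewrite permM -(eqP (src_p w)).
    by case: tpermP => // ->; rewrite uv.
  (* This identity has the transposition on the left; passing to inverses, which have the same
     orbits, moves it to the right of [p]. The orbit count drops by one, against minimality. *)
  have := porbits_mul_tperm p^-1 u v.
  rewrite porbitV nuv /= -porbitsV invMg invgK tpermV porbitsV.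
  case: eqVneq nuv => [-> | _ _ /=]; first by rewrite porbit_id.
  by rewrite addn1 addn2 => [[<-]]; rewrite ltnn.
have p_porbit u v : u \in porbit p v -> porbit p u = porbit p v.
  by rewrite -eq_porbit_mem => /eqP.
case: (pickP (@predT E)) => [x _ | E0]; last first.
  by exists [::]; split=> // u; have := E0 u.
exists (orbit p x); split; first exact: orbit_uniq.
- move=> u; have : u \in porbit p x.
    rewrite (conn _ _ u x) ?porbit_id // => {}u v /= uv.
    have uv_p : porbit p u = porbit p v.
      case/orP: uv => /eqP uv; first exact/p_porbit/same_src.
      rewrite -(p_porbit (p u) u) ?(mem_porbit _ 1) //.
      by apply/p_porbit/same_src; rewrite (eqP (src_p u)).
    by rewrite -!eq_porbit_mem uv_p.
  by case/porbitP=> i ->; rewrite permX -fconnect_orbit fconnect_iter.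
- apply: sub_cycle (cycle_orbit (@perm_inj _ p) x) => u v /= /eqP <-.
  by rewrite eq_sym.
Qed.

Section Words.

Context {T : finType}.

Definition full (w : seq T) := [forall x, x \in w].

Lemma fullP w : reflect (forall x, x \in w) (full w).
Proof. exact: forallP. Qed.

Lemma perm_full u v : perm_eq u v -> full u = full v.
Proof. by move/perm_mem=> uv; apply: eq_forallb => x; rewrite uv. Qed.

Lemma iter_rot k s (w : seq T) : s <= size w ->
  iter k (rot s) w = rot (k * s %% size w) w.
Proof.
case: (posnP (size w)) => [/size0nil -> | w_gt0] sw.
  by elim: k => // k IHk; rewrite iterS IHk.
elim: k => [|k IHk]; first by rewrite mod0n rot0.
have kw : k * s %% size w < size w by rewrite ltn_pmod.
rewrite iterS IHk rot_add_mod // ?(ltnW kw) // mulSn -modnDmr.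
case: ltngtP => [sk_w | w_sk | ->]; first by rewrite (modn_small sk_w).
  rewrite -[in RHS](subnK (ltnW w_sk)) modnDr [in RHS]modn_small //.
  by move: (leq_add sw kw) w_sk; lia.
by rewrite modnn rot_size rot0.
Qed.

(** Connectivity in dual form: [g] stands for the indicator of a closed set of edges, and turns out
    to be constant on full words. *)
Variables (n s : nat) (R : eqType) (g : seq T -> R).
Hypothesis s_n : s.+2 <= n.
Hypothesis co_sn : coprime s n.
Hypothesis s_gt0 : 0 < s.
Hypothesis g_rot : forall w, size w = n -> full w -> g (rot s w) = g w.
Hypothesis g_suffix : forall a b b', size a = s -> size (a ++ b) = n ->
  size b' = size b -> full (a ++ b) -> full (a ++ b') ->
  g (a ++ b) = g (a ++ b').

Lemma invariant_rot k w : size w = n -> full w -> g (rot k w) = g w.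
Proof.
move=> wn fw; have g_iter j : g (iter j (rot s) w) = g w.
  elim: j => //= j <-; rewrite g_rot ?iter_rot ?size_rot //; try lia.
  by rewrite (perm_full _ w) // perm_rot.
have [kn | nk] := ltnP k n; last by rewrite rot_oversize ?wn.
(* Bezout gives [a * s = b * n + 1], so [a * k] rotations by [s] amount to one by [k]. *)
have [a b ab _] := egcdnP n s_gt0.
rewrite -(g_iter (a * k)) iter_rot ?wn; last lia.
rewrite (eqnP co_sn) in ab.
by rewrite mulnAC ab mulnDl mul1n mulnAC modnMDl modn_small.
Qed.

(** Rotated to the end, the two letters lie outside the prefix of length [s], because [s <= n - 2],
    so [g_suffix] exchanges them. *)
Lemma invariant_swap a x y b : size (a ++ x :: y :: b) = n ->
  full (a ++ x :: y :: b) -> g (a ++ x :: y :: b) = g (a ++ y :: x :: b).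
Proof.
move=> ab_n f_ab.
have pE : perm_eq (a ++ x :: y :: b) (a ++ y :: x :: b).
  by rewrite perm_cat2l -[x :: _]/([:: x] ++ [:: y] ++ b) perm_catCA.
have rotE t : size t = 2 -> rot (size (a ++ t)) (a ++ t ++ b) = b ++ a ++ t.
  by rewrite catA rot_size_cat.
rewrite -(@invariant_rot (size (a ++ [:: x; y])) (a ++ x :: y :: b)) //.
rewrite -(@invariant_rot (size (a ++ [:: y; x])) (a ++ y :: x :: b));
  [| by rewrite -(perm_size pE) | by rewrite -(perm_full _ _ pE)].
rewrite (rotE [:: x; y]) // (rotE [:: y; x]) //.
rewrite !catA -(cat_take_drop s (b ++ a)) -!catA.
have ba_n : size (b ++ a) = n - 2 by move: ab_n; rewrite !size_cat /=; lia.
have f_ba t : perm_eq t [:: x; y] ->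
    full (take s (b ++ a) ++ drop s (b ++ a) ++ t).
  move=> t_xy; rewrite catA cat_take_drop -catA.
  rewrite (perm_full _ (a ++ [:: x; y] ++ b)) // perm_catC -catA perm_cat2l.
  by rewrite perm_cat2r.
apply: g_suffix; rewrite ?f_ba //.
- by rewrite size_takel // ba_n; lia.
- by rewrite catA cat_take_drop size_cat ba_n /=; lia.
- by rewrite !size_cat.
- by rewrite (perm_catC [:: y] [:: x]).
Qed.

(** The prefix [c] absorbs the first letter while the tail is permuted by induction; adjacent swaps
    then carry that letter to its place. *)
Lemma invariant_perm c u v : size (c ++ u) = n -> full (c ++ u) ->
  perm_eq u v -> g (c ++ u) = g (c ++ v).
Proof.
have move_letter a x u1 u2 : size (a ++ x :: u1 ++ u2) = n ->
    full (a ++ x :: u1 ++ u2) ->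
    g (a ++ x :: u1 ++ u2) = g (a ++ u1 ++ x :: u2).
  elim: u1 a => //= y u1 IHu a an fa; rewrite invariant_swap //.
  rewrite -!(cat_rcons y) IHu //; rewrite cat_rcons.
    by rewrite -an !size_cat.
  rewrite (perm_full _ (a ++ x :: y :: u1 ++ u2)) // perm_cat2l.
  by rewrite -[y :: _]/([:: y] ++ [:: x] ++ _) perm_catCA.
elim: u c v => [|x u IHu] c v cn fc; first by rewrite perm_sym => /perm_nilP->.
move=> xu_v; have /splitPr v_x : x \in v by rewrite -(perm_mem xu_v) mem_head.
case: v / v_x xu_v => v1 v2.
rewrite perm_sym -(cat1s x v2) perm_catCA /= perm_cons perm_sym => u_v.
rewrite -cat_rcons (IHu _ (v1 ++ v2)) ?cat_rcons // move_letter //.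
  by rewrite -cn !size_cat /= (perm_size u_v) size_cat.
by rewrite -(perm_full (c ++ x :: u)) // perm_cat2l perm_cons.
Qed.

(** Since [c] already holds every letter, the word stays full whatever follows, so letters can be
    replaced one at a time. *)
Lemma invariant_replace c t t' : full c -> size (c ++ t) = n ->
  size t = size t' -> g (c ++ t) = g (c ++ t').
Proof.
move=> fc; have fcat a : full (c ++ a).
  by apply/fullP=> x; rewrite mem_cat (fullP _ fc).
suff replace : forall t t' a, size (c ++ a ++ t) = n -> size t = size t' ->
  g (c ++ a ++ t) = g (c ++ a ++ t') by exact: (replace t t' [::]).
elim=> {t t'} [|x t IHt] [|y t'] // a cn [tt'].
rewrite -cat_rcons (IHt t') ?cat_rcons //.
(* The letter to be replaced is carried to the last position, which [g_suffix] can change. *)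
have to_end z : g (c ++ a ++ z :: t') =
    g (take s ((c ++ a) ++ t') ++ drop s ((c ++ a) ++ t') ++ [:: z]).
  rewrite [in RHS]catA cat_take_drop -!catA; apply: (invariant_perm c) => //.
    by rewrite -cn !size_cat /= tt'.
  by rewrite perm_cat2l -cat1s perm_catC.
have fz z : full (take s ((c ++ a) ++ t') ++ drop s ((c ++ a) ++ t') ++ [:: z]).
  by rewrite catA cat_take_drop -!catA.
rewrite !to_end; apply: g_suffix; rewrite ?fz //.
- by rewrite size_takel //; move: cn; rewrite !size_cat /= tt'; lia.
- by rewrite catA cat_take_drop -cn !size_cat /= tt' !addnA addn1 addnS.
- by rewrite !size_cat.
Qed.

(** Both words are permuted into one copy of the alphabet followed by spare letters, which are then
    replaced. *)
Lemma invariant_const u v : size u = n -> full u -> size v = n -> full v ->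
  g u = g v.
Proof.
have decompose w : full w -> exists t, perm_eq w (enum T ++ t).
  move=> /fullP fw; have /count_subseqP[e e_w e_T] x :
      count_mem x (enum T) <= count_mem x w.
    by rewrite count_uniq_mem ?enum_uniq // mem_enum -has_count has_pred1.
  have [t w_et] := perm_to_subseq e_w; exists t.
  by rewrite (permPl w_et) perm_cat2r perm_sym.
move=> un fu vn fv; have [[t u_t] [t' v_t']] := (decompose u fu, decompose v fv).
rewrite -[u]cat0s (invariant_perm [::] u _ _ _ u_t) //.
rewrite -[v]cat0s (invariant_perm [::] v _ _ _ v_t') //.
apply: (invariant_replace (enum T)); first by apply/fullP=> x; rewrite mem_enum.
  by rewrite -(perm_size u_t).
apply/(@addnI (size (enum T))).
by rewrite -!size_cat -(perm_size u_t) -(perm_size v_t') un.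
Qed.

End Words.

Theorem theorem4p5 (n s h : nat) (hs1 : 1 <= s) (hs2 : s <= n - 2)
    (hgcd : gcdn s n = 1) (hh : h <= n - 1) :
  exists c : seq (n.-tuple nat), is_ocycle s (@weak_order_of_height n h) c.
Proof.
pose E := {w : n.-tuple 'I_h.+1 | full w}.
have full_rot k (w : E) : full (rot_tuple k (val w)).
  by rewrite (perm_full _ (val w)) ?(valP w) // perm_rot.
pose mk (w : n.-tuple 'I_h.+1) (fw : full w) : E := exist _ w fw.
(* This rotation brings the last [s] letters to the front, where they form the source of the
   successor. *)
pose f w := mk _ (full_rot (n - s) w).
have f_inj : injective f.
  by move=> u v [/rot_inj/val_inj/val_inj].
pose src (w : E) := take s (val w); pose tgt (w : E) := drop (n - s) (val w).
have src_f w : src (perm f_inj w) = tgt w.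
  rewrite permE /src /tgt /= /rot take_size_cat // size_drop size_tuple; lia.
have s_n : s.+2 <= n by lia.
have [|c [c_uniq c_all c_cycle]] := euler_circuit _ _ src tgt _ src_f.
  move=> A A_closed u v.
  pose g (w : seq 'I_h.+1) := w \in [seq tval (val w) | w in A].
  have gE (w : E) : g (val w) = (w \in A).
    apply: (mem_image (f := fun w : E => tval (val w))).
    by move=> ? ? /val_inj/val_inj.
  have mkE (w : seq 'I_h.+1) :
      size w = n -> full w -> exists w' : E, w = val w'.
    move=> /eqP wn fw; have fw' : full (Tuple wn) by [].
    by exists (mk _ fw').
  rewrite -!gE; apply: (invariant_const n s) => //.
  - exact/eqP.
  - move=> w /mkE/[apply] [[{}w ->]].
    (* Rotation by [s] is inverse to [f], so [w] is a successor of [rot s w]. *)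
    have -> : rot s (val w) = val (mk _ (full_rot s w)) by [].
    rewrite !gE; apply: A_closed => /=; apply/orP; right.
    by rewrite /src /tgt /= /rot drop_cat size_drop size_tuple ltnn subnn drop0.
  - move=> a b b' a_s ab_n bb' /mkE-/(_ ab_n)[w w_ab].
    have ab'_n : size (a ++ b') = n by rewrite size_cat bb' -size_cat.
    move=> /mkE-/(_ ab'_n)[w' w'_ab]; rewrite w_ab w'_ab !gE; apply: A_closed.
    by rewrite /= /src -w_ab -w'_ab -a_s !take_size_cat ?eqxx.
  - by rewrite size_tuple.
  - exact: (valP u).
  - by rewrite size_tuple.
  - exact: (valP v).
pose to_nat (w : E) := map_tuple (@nat_of_ord h.+1) (val w).
have to_nat_inj : injective to_nat.
  by move=> u v [/(inj_map val_inj)/val_inj/val_inj].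
exists (map to_nat c); split.
- by rewrite map_inj_uniq.
- move=> w; apply: (iff_trans _ (iff_sym (weak_order_of_heightP w hh))); split.
    case/mapP=> u _ -> x; apply/mapP/idP=> [[i _ ->] | xh].
      by rewrite -ltnS ltn_ord.
    by exists (Ordinal (xh : x < h.+1)); rewrite // (fullP _ (valP u)).
  (* No letter of [w] exceeds [h], so [inord] never falls back on its default. *)
  move=> wE; have inordK_w : map (@nat_of_ord h.+1) (map inord w) = w.
    rewrite -map_comp -[RHS]map_id; apply/eq_in_map => x.
    by rewrite wE => /inordK.
  have fw : full (map_tuple (@inord h) w).
    apply/fullP=> i; rewrite -(inord_val i) map_f // wE -ltnS ltn_ord //.
  apply/mapP; exists (mk _ fw) => //.
  by apply: val_inj; rewrite /= inordK_w.
- rewrite cycle_map; apply: sub_cycle c_cycle => u v /= /eqP uv.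
  by rewrite /overlap /= -map_drop -map_take -/(tgt u) uv.
Qed.
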